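(* Let $X$ be a non-trivial real Hausdorff locally convex space with topological dual $X^*$ and let $C\subset X$. The following are equivalent: (i) $N_C$ is maximal monotone; (ii) $\varphi_{N_C}(x,x^* )=\iota_C(x)+\sigma_C(x^* )$ for all $(x,x^* )\in X\times X^*$; (iii) $C^{\#}\subset C$ (equivalently, $C^{\#}=C$); (iv) $C=\{x\in X\mid \varphi_{N_C}(x,0)\le 0\}$.
   Context: $\langle x,x^*\rangle:=x^*(x)$. For $T:X\rightrightarrows X^*$, $\operatorname{Graph}T=\{(x,x^* )\in X\times X^*\mid x^*\in T(x)\}$. $T$ is monotone if $\langle x_1-x_2,x_1^*-x_2^*\rangle\ge 0$ for all $(x_1,x_1^* ),(x_2,x_2^* )\in\operatorname{Graph}T$, and maximal monotone if it is monotone and its graph is not properly contained in the graph of another monotone operator from $X$ to $X^*$. Conventions: $\sup\emptyset=-\infty$, $\inf\emptyset=+\infty$, $\infty-\infty=\infty$. For $C\subset X$: $\iota_C(x)=0$ if $x\in C$, $\iota_C(x)=+\infty$ if $x\in X\setminus C$; $\sigma_C(x^* )=\sup\{\langle x,x^*\rangle\mid x\in C\}$; the normal cone $N_C:X\rightrightarrows X^*$ is $N_C(a)=\{a^*\in X^*\mid \langle y-a,a^*\rangle\le 0\ \forall y\in C\}$ if $a\in C$ and $N_C(a)=\emptyset$ if $a\notin C$. The portable hull of $C$ is $C^{\#}:=\{x\in X\mid \forall (a,a^* )\in\operatorname{Graph}N_C,\ \langle x-a,a^*\rangle\le 0\}$; one always has $C\subset C^{\#}$. The Fitzpatrick function of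 $T$ is $\varphi_T(x,x^* )=\sup\{\langle x-a,a^*\rangle+\langle a,x^*\rangle\mid (a,a^* )\in\operatorname{Graph}T\}$, $(x,x^* )\in X\times X^*$. *)

(* Defs.v *)
From HB Require Import structures.
From mathcomp Require Import all_boot all_order all_algebra.
From mathcomp Require Import boolp classical_sets functions.
From mathcomp Require Import reals constructive_ereal ereal topology.
From mathcomp Require Import tvs normedtype.

Set Implicit Arguments.
Unset Strict Implicit.
Unset Printing Implicit Defensive.

Import Order.TTheory GRing.Theory Num.Theory.
Import numFieldTopology.Exports numFieldNormedType.Exports.

Local Open Scope classical_set_scope.
Local Open Scope ring_scope.

Section TopologicalDual.
Context {R : realType} {X : tvsType R}.

Definition is_dual : {pred X -> R^o} :=
  fun f => `[< linear f /\ continuous f >].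

Lemma is_dual_submod_closed : submod_closed is_dual.
Proof.
split.
  apply/asboolP; split; last by move=> x; exact: cvg_cst.
  by move=> a u v; rewrite /= scaler0 addr0.
move=> a f g /asboolP[lf cf] /asboolP[lg cg]; apply/asboolP; split.
  move=> b u v.
  change (a *: f (b *: u + v) + g (b *: u + v) =
          b *: (a *: f u + g u) + (a *: f v + g v)).
  by rewrite lf lg !scalerDr !scalerA (mulrC a b) addrACA.
move=> x; apply: (@cvgD _ R^o _ _ _ (a \*: f) g); last exact: cg.
exact: (cvgZl_tmp (cf x)).
Qed.

HB.instance Definition _ :=
  GRing.isSubmodClosed.Build R (X -> R^o) is_dual is_dual_submod_closed.

End TopologicalDual.

Section Dual.
Context {R : realType} (X : tvsType R).

Record dual := Dual { dual_fun : X -> R^o; dual_funP : dual_fun \in is_dual }.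

HB.instance Definition _ := [isSub for dual_fun].
HB.instance Definition _ := gen_eqMixin dual.
HB.instance Definition _ := gen_choiceMixin dual.
HB.instance Definition _ := [SubChoice_isSubZmodule of dual by <:].
HB.instance Definition _ := [SubZmodule_isSubLmodule of dual by <:].

End Dual.

Definition pairing {R : realType} {X : tvsType R} (x : X) (x' : dual X) : R :=
  dual_fun x' x.

Notation "⟨ x , x' ⟩" := (pairing x x')
  (at level 0, x at level 99, x' at level 99, format "⟨ x ,  x' ⟩").

Section MonotoneOperators.
Context {R : realType} {X : tvsType R}.
Implicit Types (T S : X -> set (dual X)) (C : set X).

Definition graph T : set (X * dual X) := [set p | T p.1 p.2].

Definition monotone T : Prop :=
  forall x1 x1' x2 x2', graph T (x1, x1') -> graph T (x2, x2') ->
    0 <= ⟨ x1 - x2, x1' - x2' ⟩.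

Definition maximal_monotone T : Prop :=
  monotone T /\ ~ exists2 S, monotone S & graph T `<` graph S.

Definition indicator_fun C (x : X) : \bar R :=
  if x \in C then 0%E else +oo%E.

Definition support_fun C (x' : dual X) : \bar R :=
  ereal_sup [set (⟨ x, x' ⟩)%:E | x in C].

Definition normal_cone C (a : X) : set (dual X) :=
  [set a' | C a /\ forall y, C y -> ⟨ y - a, a' ⟩ <= 0].

Definition portable_hull C : set X :=
  [set x | forall a a', graph (normal_cone C) (a, a') -> ⟨ x - a, a' ⟩ <= 0].

Definition fitzpatrick T (x : X) (x' : dual X) : \bar R :=
  ereal_sup [set (⟨ x - p.1, p.2 ⟩ + ⟨ p.1, x' ⟩)%:E | p in graph T].

End MonotoneOperators.

(* Main.v *)
Require Import Defs.
From mathcomp Require Import all_boot all_order all_algebra.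
From mathcomp Require Import boolp classical_sets functions.
From mathcomp Require Import reals constructive_ereal ereal topology.
From mathcomp Require Import tvs normedtype.

Import Order.TTheory GRing.Theory Num.Theory.
Import DualAddTheory.
Local Open Scope classical_set_scope.
Local Open Scope ring_scope.

(** Everything rests on two features of a normal cone: its values are cones,
    and they contain the zero functional at every point of [C].

    Scaling [a'] by large [t >= 0] in the inequality
    [⟨x - a, x'⟩ >= t ⟨x - a, a'⟩] forces [⟨x - a, a'⟩ <= 0].  Hence a pair
    [(x, x')] that can be added monotonically to the graph of [normal_cone C]
    has [x] in the portable hull, and conversely [(x, 0)] can be added for each
    [x] in the hull.  If [x] lies in [C], the pairs [(y, 0)] with [y] in [C]
    moreover say exactly that [x'] is normal to [C] at [x].  So maximality means
    that the hull adds no point to [C] ([maximal_monotone_normal_coneP]).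

    The same scaling computes the Fitzpatrick function for arbitrary [C]: it is
    the indicator of the portable hull plus the support function of [C]
    ([fitzpatrick_normal_cone]).  Equality with the indicator of [C] plus the
    same support function therefore amounts to the hull being [C], and the
    points where the Fitzpatrick function at [0] is nonpositive form the hull
    itself ([portable_hullE]). *)

(** * The duality pairing *)

(* Simplification would otherwise push evaluation through sums of functionals. *)
Arguments pairing : simpl never.

Section Pairing.
Context {R : realType} {X : tvsType R}.

Lemma pairing_linear (x' : dual X) : linear (dual_fun x').
Proof. by have /asboolP[] := dual_funP x'. Qed.

Lemma pairingBl (x y : X) (x' : dual X) : ⟨ x - y, x' ⟩ = ⟨ x, x' ⟩ - ⟨ y, x' ⟩.
Proof.
by rewrite /pairing addrC -scaleN1r pairing_linear scaleN1r addrC.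
Qed.

Lemma pairingBr (x : X) (x' y' : dual X) : ⟨ x, x' - y' ⟩ = ⟨ x, x' ⟩ - ⟨ x, y' ⟩.
Proof. by []. Qed.

Lemma pairingZr (t : R) (x : X) (x' : dual X) : ⟨ x, t *: x' ⟩ = t * ⟨ x, x' ⟩.
Proof. by []. Qed.

Lemma pairing0r (x : X) : ⟨ x, 0 : dual X ⟩ = 0.
Proof. by []. Qed.

Lemma pairing0l (x' : dual X) : ⟨ 0, x' ⟩ = 0.
Proof. by rewrite -(subrr (0 : X)) pairingBl subrr. Qed.

Lemma pairingBC (x y : X) (x' y' : dual X) : ⟨ x - y, x' - y' ⟩ = ⟨ y - x, y' - x' ⟩.
Proof.
by rewrite !pairingBr !pairingBl opprB [in RHS]opprB addrC.
Qed.

End Pairing.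

(** * Maximality, pair by pair *)

Section Maximality.
Context {R : realType} {X : tvsType R}.
Implicit Types T : X -> set (dual X).

(** Any proper monotone extension contains a new pair, and adjoining just that
    pair is already monotone, so maximality can be tested on single pairs. *)
Lemma maximal_monotoneP T : monotone T ->
  maximal_monotone T <->
  forall x x', (forall a a', T a a' -> 0 <= ⟨ x - a, x' - a' ⟩) -> T x x'.
Proof.
move=> monT; split=> [[_ maxT] x x' xT|relT].
  apply: contrapT => nTx; apply: maxT.
  exists (fun y => T y `|` [set y' | y = x /\ y' = x']).
    move=> x1 x1' x2 x2' [T1|[/= -> ->]] [T2|[/= -> ->]].
    - exact: (monT _ _ _ _ T1 T2).
    - by rewrite pairingBC; apply: xT.
    - exact: xT.
    - by rewrite subrr pairing0l.
  split=> [[y y'] Ty|sub]; first by left.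
  by apply/nTx/(sub (x, x')); right.
split=> // -[S monS [TS nST]]; apply: nST => -[x x'] Sx.
by apply: relT => a a' Ta; apply: monS Sx _; apply: (TS (a, a')).
Qed.

End Maximality.

(** * Normal cones and the portable hull *)

Section NormalCone.
Context {R : realType} {X : tvsType R}.
Implicit Types C : set X.

Lemma normal_cone0 C a : C a -> normal_cone C a 0.
Proof. by move=> Ca; split=> // y _; rewrite pairing0r. Qed.

Lemma normal_coneZ C a a' (t : R) :
  0 <= t -> normal_cone C a a' -> normal_cone C a (t *: a').
Proof.
move=> t0 [Ca nCa]; split=> // y Cy.
by rewrite pairingZr mulr_ge0_le0// nCa.
Qed.

Lemma monotone_normal_cone C : monotone (normal_cone C).
Proof.
move=> x1 x1' x2 x2' [/= C1 n1] [/= C2 n2].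
rewrite pairingBr subr_ge0 (le_trans (n2 _ C1))//.
by rewrite -oppr_le0; have := n1 _ C2; rewrite !pairingBl opprB.
Qed.

Lemma sub_portable_hull C : C `<=` portable_hull C.
Proof. by move=> x Cx a a' [_]; apply. Qed.

(** Nonnegative multiples of [a'] stay in the cone, so a bound uniform over
    the cone is only possible if the pairing is nonpositive. *)
Lemma portable_hull_bounded C x :
  (forall a, exists M : R,
     forall a', normal_cone C a a' -> ⟨ x - a, a' ⟩ <= M) ->
  portable_hull C x.
Proof.
move=> bnd a a' nCa; rewrite leNgt; apply/negP => p_gt0.
have [M leM] := bnd a.
have M0 : 0 <= M by rewrite -(pairing0r (x - a)); apply/leM/normal_cone0/nCa.1.
(* The multiple is chosen so that the pairing equals [M + 1]. *)
have t0 : 0 <= (M + 1) / ⟨ x - a, a' ⟩.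
  by apply: divr_ge0 (ltW p_gt0); rewrite addr_ge0.
have := leM _ (normal_coneZ _ _ _ _ t0 nCa).
by rewrite pairingZr divfK ?gt_eqF// gerDl ler10.
Qed.

(** Points of the hull are those over which the graph can be extended
    monotonically, [0] being always an admissible functional there. *)
Lemma maximal_monotone_normal_coneP C :
  maximal_monotone (normal_cone C) <-> portable_hull C `<=` C.
Proof.
rewrite maximal_monotoneP; last exact: monotone_normal_cone.
split=> [maxC x Hx|HC x x' rel].
  have [] // : normal_cone C x 0.
  apply: maxC => a a' nCa.
  by rewrite pairingBr pairing0r sub0r oppr_ge0; apply: Hx.
split.
  apply/HC/portable_hull_bounded => a; exists ⟨ x - a, x' ⟩ => a' /rel.
  by rewrite pairingBr subr_ge0.
move=> y /normal_cone0 /rel; rewrite subr0.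
by rewrite !pairingBl subr_ge0 subr_le0.
Qed.

(** On the hull, for each fixed [a] in [C], the term [⟨x - a, a'⟩] is
    nonpositive and vanishes at [a' = 0], which leaves the support function;
    off the hull the supremum is infinite by scaling.  With the dual addition
    this covers empty [C] as well, whose hull is the whole space. *)
Lemma fitzpatrick_normal_cone C x x' :
  fitzpatrick (normal_cone C) x x' =
  (indicator_fun (portable_hull C) x + support_fun C x')%dE.
Proof.
rewrite /indicator_fun; case: ifPn => [/set_mem Hx|nHx].
  rewrite dadd0e; apply/eqP; rewrite eq_le; apply/andP; split.
    apply: ge_ereal_sup => _ [[a a'] /= nCa <-].
    apply: (@le_trans _ _ ⟨ a, x' ⟩%:E).
      by rewrite lee_fin gerDr; apply: Hx.
    by apply: ereal_sup_ubound; exists a => //; case: nCa.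
  apply: ge_ereal_sup => _ [a Ca <-]; apply: ereal_sup_ubound.
  exists (a, 0); first exact: normal_cone0.
  by rewrite /= pairing0r add0r.
rewrite daddye; apply/eqP; rewrite -leye_eq leNgt; apply/negP => fin.
move/negP: nHx; apply; apply/mem_set/portable_hull_bounded => a.
have ub a' : normal_cone C a a' ->
    ((⟨ x - a, a' ⟩ + ⟨ a, x' ⟩)%:E <= fitzpatrick (normal_cone C) x x')%E.
  by move=> nCa; apply: ereal_sup_ubound; exists (a, a').
case: (fitzpatrick _ _ _) fin ub => [r _ ub|//|_ ub].
  by exists (r - ⟨ a, x' ⟩) => a' /ub; rewrite lee_fin lerBrDr.
(* A supremum equal to [-oo] means that the graph is empty: any bound will do. *)
by exists 0 => a' /ub; rewrite leeNy_eq.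
Qed.

Lemma portable_hullE C :
  portable_hull C =
  [set x | (fitzpatrick (normal_cone C) x (0 : dual X)%R <= 0)%E].
Proof.
apply/seteqP; split=> x /=.
  move=> Hx; apply: ge_ereal_sup => _ [[a a'] /= nCa <-].
  by rewrite pairing0r addr0 lee_fin; apply: Hx.
move=> phi_le0 a a' nCa; rewrite -lee_fin; apply: le_trans phi_le0.
by apply: ereal_sup_ubound; exists (a, a') => //=; rewrite pairing0r addr0.
Qed.

End NormalCone.

(* The sum in the second item is the dual addition of \bar R, for which
   +oo + -oo = +oo. *)
Theorem theorem2 (R : realType) (X : tvsType R)
    (X_hausdorff : hausdorff_space X) (X_nontrivial : exists x : X, x != 0)
    (C : set X) :
  [<-> maximal_monotone (normal_cone C);
       forall (x : X) (x' : dual X),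
         fitzpatrick (normal_cone C) x x' =
         (indicator_fun C x + support_fun C x')%dE;
       portable_hull C `<=` C;
       portable_hull C = C;
       C = [set x | (fitzpatrick (normal_cone C) x (0 : dual X)%R <= 0)%E]].
Proof.
tfae.
- move/maximal_monotone_normal_coneP => HC x x'.
  have HE : portable_hull C = C.
    by apply/seteqP; split=> //; exact: sub_portable_hull.
  by rewrite fitzpatrick_normal_cone HE.
- move=> phiE x; rewrite portable_hullE /= phiE /indicator_fun.
  by case: ifPn => [/set_mem//|_]; rewrite daddye.
- by move=> HC; apply/seteqP; split=> //; exact: sub_portable_hull.
- by rewrite portable_hullE => {1}<-.
- rewrite -portable_hullE => CE.
  by apply/maximal_monotone_normal_coneP; rewrite -CE.
Qed.
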